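(* Let $f:\mathbb{R}^d\to\mathbb{R}\cup\{+\infty\}$ be a proper, closed function with at least one global minimizer, and suppose that $f$ is strictly quasiconvex. Then $f\in\mathcal{F}_{\mathbf{I}}^{\mathrm{BA}}(t)$ for every $t>0$.
   Context: Strictly quasiconvex means $f((1-\lambda)x+\lambda y)<\max\{f(x),f(y)\}$ for all $x\neq y$ in $\mathbb{R}^d$ and all $\lambda\in(0,1)$. Let $\langle\cdot,\cdot\rangle$, $\|\cdot\|$ be the Euclidean inner product and norm and $\mathcal{B}(x,t)=\{z\in\mathbb{R}^d:\|z-x\|\le t\}$. For $f:\mathbb{R}^d\to\mathbb{R}\cup\{+\infty\}$, $\operatorname{dom} f=\{x: f(x)<+\infty\}$; $f$ is proper if $\operatorname{dom} f\ne\emptyset$ and closed if it is lower semicontinuous; $\mathcal{X}_f$ is the set of global minimizers of $f$; $\mathrm{brox}^t_f(x)=\arg\min_{z\in\mathcal{B}(x,t)}f(z)$ (a set); $\mathcal{X}_f+\mathcal{B}(0,t)$ is the Minkowski sum. The class $\mathcal{F}_{\mathbf{I}}^{\mathrm{BA}}(t)$ consists of all proper, closed $f:\mathbb{R}^d\to\mathbb{R}\cup\{+\infty\}$ such that both of the following hold. (A) There exists $x_\star\in\mathcal{X}_f$ such that for every $x\in\operatorname{dom} f\setminus(\mathcal{X}_f+\mathcal{B}(0,t))$ and every $u\in\mathrm{brox}^t_f(x)$, $\langle x-u,\,x_\star-u\rangle\le 0$. (B) For all $x\in\operatorname{dom} f$: if $\mathrm{brox}^t_f(x)=\{x\}$,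 then $x\in\mathcal{X}_f$. *)

(* Defs.v *)
From HB Require Import structures.
From mathcomp Require Import all_boot all_order all_algebra.
From mathcomp Require Import all_classical all_reals all_analysis.
Import Order.TTheory GRing.Theory Num.Theory.
Import numFieldNormedType.Exports.

Set Implicit Arguments.
Unset Strict Implicit.
Unset Printing Implicit Defensive.

Local Open Scope classical_set_scope.
Local Open Scope ring_scope.

Section ball_proximal.
Context {R : realType} {d : nat}.
Implicit Types (x y z : 'rV[R]_d) (t : R) (f : 'rV[R]_d -> \bar R).

Definition dotv x y : R := \sum_(i < d) x 0 i * y 0 i.

(* The library norm `|x| on 'rV[R]_d is the sup norm, hence this definition. *)
Definition enorm x : R := Num.sqrt (dotv x x).

Definition eball x t : set 'rV[R]_d := [set z | enorm (z - x) <= t].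

Definition minkowski_sum (A B : set 'rV[R]_d) : set 'rV[R]_d :=
  [set a + b | a in A & b in B].

(* f takes its values in R \cup {+oo}, seen inside \bar R. *)
Definition above_ninfty f := forall x, f x != -oo%E.

Definition edom f : set 'rV[R]_d := [set x | (f x < +oo)%E].

Definition eproper f := edom f !=set0.

(* The topology on 'rV[R]_d is the product one, i.e. the Euclidean one. *)
Definition eclosed f := lower_semicontinuous f.

Definition argmin_on (A : set 'rV[R]_d) f : set 'rV[R]_d :=
  [set u | A u /\ forall z, A z -> (f u <= f z)%E].

Definition minimizers f : set 'rV[R]_d := argmin_on setT f.

Definition brox t f x : set 'rV[R]_d := argmin_on (eball x t) f.

(* The points x and y range over the whole space, not only over edom f. *)
Definition strictly_quasiconvex f :=
  forall x y (l : R), x != y -> 0 < l < 1 ->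
    (f ((1 - l) *: x + l *: y)%R < maxe (f x) (f y))%E.

Definition FI_BA t : set ('rV[R]_d -> \bar R) :=
  [set f | [/\ above_ninfty f, eproper f, eclosed f,
    exists2 xs, minimizers f xs &
      forall x u,
        (edom f `\` minkowski_sum (minimizers f) (eball 0 t)) x ->
        brox t f x u -> dotv (x - u) (xs - u) <= 0
  & forall x, edom f x -> brox t f x = [set x] -> minimizers f x]].

End ball_proximal.

(* Main.v *)
Require Import Defs.
From mathcomp Require Import all_boot all_order all_algebra.
From mathcomp Require Import all_classical all_reals all_analysis.
From mathcomp Require Import ring lra.
Import Order.TTheory GRing.Theory Num.Theory.
Import numFieldNormedType.Exports.

Local Open Scope classical_set_scope.
Local Open Scope ring_scope.

(** Moving from a point [u] a little way towards a global minimizer [xs]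
    strictly decreases a strictly quasiconvex function, because
    [f xs <= f u].  Hence if [u] minimizes [f] on a set, that set contains no
    point of the open segment from [u] to [xs]
    ([segment_notin_argmin_on]).  For the ball of radius [t] around [x], a
    violation of either condition of the class would produce such a point:
    - if [dotv (x - u) (xs - u) > 0], the direction of [xs] makes an acute angle
      with that of the centre [x], so a short step from [u] gets closer to [x]
      and stays in the ball ([segment_acute_closer]);
    - if [u = x] is the centre and not a global minimizer, every sufficiently
      short step stays in the ball, whose radius is positive
      ([segment_in_eball]). *)

Section segment.
Context {R : realType} {d : nat}.
Implicit Types (x y u xs : 'rV[R]_d) (f : 'rV[R]_d -> \bar R).

Lemma dotv_ge0 x : 0 <= dotv x x.
Proof. by apply: sumr_ge0 => i _; rewrite -expr2 sqr_ge0. Qed.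

Lemma dotv0r x : dotv x 0 = 0.
Proof. by rewrite /dotv big1 // => i _; rewrite mxE mulr0. Qed.

Lemma dotv_segment x u y (l : R) :
  dotv ((1 - l) *: u + l *: y - x) ((1 - l) *: u + l *: y - x) =
  dotv (u - x) (u - x) - 2 * l * dotv (x - u) (y - u)
  + l ^+ 2 * dotv (y - u) (y - u).
Proof.
rewrite /dotv !mulr_sumr -sumrB -big_split /=; apply: eq_bigr => i _.
by rewrite !mxE; ring.
Qed.

(** The squared distance to [x] along the segment from [u] to [y] is a quadratic
    polynomial whose slope at [u] is [- 2 * dotv (x - u) (y - u)], which is
    negative. *)
Lemma segment_acute_closer x u y : 0 < dotv (x - u) (y - u) ->
  exists2 l : R, 0 < l < 1 &
    enorm ((1 - l) *: u + l *: y - x) <= enorm (u - x).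
Proof.
set p := dotv (x - u) (y - u) => p_gt0.
have q_ge0 := dotv_ge0 (y - u); set q := dotv (y - u) (y - u) in q_ge0.
have s_gt0 : 0 < 2 * p + q by lra.
(* The distance decreases as long as l * q <= 2 * p; the summand 2 * p of the
   denominator keeps l below 1 for every q >= 0. *)
pose l := p / (2 * p + q); have lE : l * (2 * p + q) = p.
  by rewrite /l mulfVK // gt_eqF.
have l_gt0 : 0 < l by rewrite divr_gt0.
exists l; first by rewrite l_gt0 ltr_pdivrMr //; lra.
by apply: ler_wsqrtr; rewrite dotv_segment -/p -/q; nra.
Qed.

Lemma segment_in_eball x y (t : R) : 0 < t ->
  exists2 l : R, 0 < l < 1 & eball x t ((1 - l) *: x + l *: y).
Proof.
move=> t_gt0; have n_ge0 : 0 <= enorm (y - x) by rewrite sqrtr_ge0.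
have s_gt0 : 0 < 2 * t + enorm (y - x) by lra.
pose l := t / (2 * t + enorm (y - x)).
have l_gt0 : 0 < l by rewrite divr_gt0.
exists l; first by rewrite l_gt0 ltr_pdivrMr //; lra.
rewrite /eball /= {1}/enorm dotv_segment subrr dotv0r.
have -> : dotv (0 : 'rV[R]_d) (y - x) = 0.
  by rewrite /dotv big1 // => i _; rewrite mxE mul0r.
rewrite mulr0 subr0 add0r sqrtrM ?sqr_ge0// sqrtr_sqr gtr0_norm// -/(enorm _).
by rewrite /l mulrAC ler_pdivrMr //; nra.
Qed.

Lemma segment_notin_argmin_on f (A : set 'rV[R]_d) u xs (l : R) :
  strictly_quasiconvex f -> minimizers f xs -> argmin_on A f u ->
  u != xs -> 0 < l < 1 -> ~ A ((1 - l) *: u + l *: xs).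
Proof.
move=> f_sqc [_ xs_min] [_ u_min] neq l01 /u_min; apply/negP; rewrite -ltNge.
by have := f_sqc _ _ _ neq l01; rewrite (max_idPl (xs_min u I)).
Qed.

End segment.

Theorem theorem5p1 (R : realType) (d : nat) (f : 'rV[R]_d -> \bar R)
    (f_ninfty : above_ninfty f) (f_proper : eproper f) (f_closed : eclosed f)
    (f_min : minimizers f !=set0) (f_sqc : strictly_quasiconvex f) :
  forall t : R, 0 < t -> FI_BA t f.
Proof.
move=> t t_gt0; have [xs xs_min] := f_min; split=> //.
  exists xs => // x u _ u_brox; rewrite leNgt; apply/negP => acute.
  have neq : u != xs.
    by apply: contraTneq acute => ->; rewrite subrr dotv0r ltxx.
  have [l l01 closer] := segment_acute_closer _ _ _ acute.
  apply: (segment_notin_argmin_on _ _ _ _ _ f_sqc xs_min u_brox neq l01).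
  by apply: le_trans closer _; case: u_brox.
move=> x _ broxE; have [<- //|neq] := eqVneq xs x.
have x_brox : brox t f x x by rewrite broxE.
have [l l01 in_ball] := segment_in_eball x xs _ t_gt0.
by case: (segment_notin_argmin_on _ _ _ _ _ f_sqc xs_min x_brox _ l01 in_ball);
  rewrite eq_sym.
Qed.
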